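(* Let $G$ be a graph of order $n$ without isolated vertices. Then $col(G)\leq 2H(G)$, with equality if and only if $G\cong K_n$.
   Context: Graphs are finite, simple, undirected, with nonempty vertex set; the order of a graph is its number of vertices, and $d(u)$ denotes the degree of a vertex $u$ in $G$. The Harmonic index of $G$ is $H(G)=\sum_{uv\in E(G)}\frac{2}{d(u)+d(v)}$. The coloring number $col(G)$ is the smallest integer $k$ for which there exists a linear ordering of the vertices of $G$ such that each vertex is preceded by fewer than $k$ of its neighbors. *)

(* Defs.v *)
From HB Require Import structures.
From mathcomp Require Import all_boot all_order all_algebra.

Set Implicit Arguments.
Unset Strict Implicit.
Unset Printing Implicit Defensive.

Import Order.TTheory GRing.Theory Num.Theory.

Local Open Scope ring_scope.

(* Nonemptiness of the vertex set is not part of the record, so that the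
   complete graph is defined for every n. *)
Record sgraph := SGraph {
  vertex :> finType;
  adj : rel vertex;
  adj_sym : symmetric adj;
  adj_irr : irreflexive adj
}.

Definition gorder (G : sgraph) : nat := #|{: G}|.

Definition deg (G : sgraph) (u : G) : nat := #|[set v : G | adj u v]|.

Definition no_isolated (G : sgraph) : Prop := forall u : G, (0 < deg u)%N.

Definition edges (G : sgraph) : {set {set G}} :=
  [set [set e.1; e.2] | e : G * G & adj e.1 e.2].

(* For an edge A = {u, v}, u != v, the inner sum is d(u) + d(v). *)
Definition harmonic (G : sgraph) : rat :=
  \sum_(A in edges G) 2 / (\sum_(w in A) deg w)%N%:R.

(* A linear ordering is encoded by the injective map p sending each vertex to
   its position. *)
Definition has_col_order (G : sgraph) (k : nat) : bool :=
  [exists p : {ffun G -> 'I_(gorder G)},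
     injectiveb p &&
     [forall v : G, (#|[set u : G | adj v u & (p u < p v)%N]| < k)%N]].

Lemma ex_col_order (G : sgraph) : exists k, has_col_order G k.
Proof.
exists (gorder G).+1; apply/existsP; exists [ffun v => enum_rank v].
apply/andP; split.
  by apply/injectiveP => u v; rewrite !ffunE => /enum_rank_inj.
by apply/forallP => v; rewrite ltnS max_card.
Qed.

Definition coloring_number (G : sgraph) : nat := ex_minn (ex_col_order G).

Definition isomorphic (G H : sgraph) : Prop :=
  exists2 f : G -> H, bijective f & forall u v : G, adj (f u) (f v) = adj u v.

Definition complete_rel (n : nat) : rel 'I_n := fun i j => i != j.

Lemma complete_sym (n : nat) : symmetric (@complete_rel n).
Proof. by move=> i j; rewrite /complete_rel eq_sym. Qed.

Lemma complete_irr (n : nat) : irreflexive (@complete_rel n).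
Proof. by move=> i; rewrite /complete_rel eqxx. Qed.

Definition complete (n : nat) : sgraph :=
  SGraph (@complete_sym n) (@complete_irr n).

(* Main.v *)
Require Import Defs.
From mathcomp Require Import all_boot all_order all_algebra.
From mathcomp Require Import zify ring lra.

Set Implicit Arguments.
Unset Strict Implicit.
Unset Printing Implicit Defensive.

Import Order.TTheory GRing.Theory Num.Theory.

Local Open Scope ring_scope.

(** Summed over ordered pairs of adjacent vertices, the harmonic index becomes
    H(S), the sum of 1 / (d(u) + d(w)), a quantity that makes sense for every
    induced subgraph, represented here by its vertex set S with degrees taken
    inside S.  The bound rests on three facts.

    1. If k is the coloring number, then some nonempty T induces a subgraph
       of minimum degree at least k - 1 ([dense_core]): otherwise repeatedly
       placing a vertex of small degree last would produce an ordering in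
       which every vertex has fewer than k - 1 earlier neighbors.

    2. Deleting a vertex of minimum degree never increases H, and strictly
       decreases it if that vertex is not isolated ([harmonic_in_peel]).
       Deleting vertices of degree less than k - 1 never touches T, so from
       the whole graph one reaches a subgraph of minimum degree at least
       k - 1 ([harmonic_in_core]).

    3. A nonempty graph of minimum degree at least d > 0 satisfies
       d + 1 <= 2 H ([harmonic_in_min_deg]).  With m vertices and maximum
       degree M, each vertex contributes at least d / (d + M) and a vertex of
       degree M at least 1 / 2, so that 2 H >= 1 + 2 (m - 1) d / (d + M),
       where d <= M <= m - 1.

    Equality with d = k - 1 excludes any strict step in 2 when no vertex is
    isolated, and in 3 it forces m - 1 <= d, so that G is a clique.
    Conversely, in a clique on n > 1 vertices 2 H = n, while the last vertex
    of any ordering is preceded by its n - 1 neighbors, so k >= n. *)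

(** * Degrees and the harmonic index of induced subgraphs *)

Definition nbrs (G : sgraph) (S : {set G}) (u : G) : {set G} :=
  [set w in S | adj u w].

Definition deg_in (G : sgraph) (S : {set G}) (u : G) : nat := #|nbrs S u|.

Definition harmonic_in (G : sgraph) (S : {set G}) : rat :=
  \sum_(u in S) \sum_(w in nbrs S u) (deg_in S u + deg_in S w)%N%:R^-1.

Definition is_clique (G : sgraph) (S : {set G}) : Prop :=
  {in S &, forall u v, u != v -> adj u v}.

Lemma deg_in_setT (G : sgraph) (u : G) : deg_in [set: G] u = deg u.
Proof. by rewrite /deg_in /deg; apply: eq_card => w; rewrite !inE. Qed.

Lemma in_nbrs_sym (G : sgraph) (S : {set G}) (u w : G) :
  (u \in S) && (w \in nbrs S u) = (w \in S) && (u \in nbrs S w).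
Proof. by rewrite !inE adj_sym; case: (u \in S); case: (w \in S). Qed.

Lemma sum_nbrs_const (G : sgraph) (S : {set G}) (u : G) (c : rat) :
  \sum_(w in nbrs S u) c = (deg_in S u)%:R * c.
Proof. by rewrite sumr_const mulr_natl. Qed.

Lemma sum_nbrs_swap (G : sgraph) (S : {set G}) (F : G -> G -> rat) :
  \sum_(u in S) \sum_(w in nbrs S u) F u w
    = \sum_(u in S) \sum_(w in nbrs S u) F w u.
Proof.
rewrite (exchange_big_dep (mem S)) => [|u w _]; last by rewrite inE => /andP[].
apply: eq_bigr => w /= wS; apply: eq_bigl => u.
by rewrite in_nbrs_sym [w \in S]wS.
Qed.

Lemma nbr_deg_gt0 (G : sgraph) (S : {set G}) (u w : G) :
  w \in nbrs S u -> (0 < deg_in S u)%N.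
Proof. by move=> wu; apply/card_gt0P; exists w. Qed.

(** Each edge {x, y} is the image of exactly the two pairs (x, y) and (y, x),
    which accounts for the numerator 2 in the harmonic index. *)
Lemma harmonic_setT (G : sgraph) : harmonic G = harmonic_in [set: G].
Proof.
have -> : harmonic_in [set: G]
    = \sum_(e in [pred e : G * G | adj e.1 e.2]) (deg e.1 + deg e.2)%N%:R^-1.
  rewrite -(pair_big_dep xpredT (fun u v : G => adj u v)
              (fun u v => (deg u + deg v)%N%:R^-1 : rat)) /=.
  rewrite /harmonic_in; apply: eq_big => [u|u _]; first by rewrite inE.
  by apply: eq_big => [w|w _]; rewrite ?inE // !deg_in_setT.
rewrite (partition_big_imset (fun e : G * G => [set e.1; e.2])).
have edgesE : edges G = (fun e : G * G => [set e.1; e.2])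
                          @: [pred e : G * G | adj e.1 e.2].
  apply/setP => A; apply/imsetP/imsetP=> -[e ae ->]; exists e => //;
    by rewrite !inE in ae *.
rewrite /harmonic edgesE; apply: eq_bigr => _ /imsetP[[x y] /= axy ->].
have nxy : x != y by apply: contraTneq axy => ->; rewrite unfold_in /= adj_irr.
rewrite unfold_in /= in axy.
rewrite big_setU1 ?inE //= big_set1.
rewrite (eq_bigl (mem [set (x, y); (y, x)])); last first.
  move=> [a b]; rewrite !inE /= !xpair_eqE; apply/idP/idP.
    case/andP=> ab /eqP/setP E; have := E a; have := E b.
    rewrite !inE !eqxx /= orbT.
    have nab : a != b by apply: contraTneq ab => ->; rewrite adj_irr.
    move=> /esym/orP[]/eqP bE /esym/orP[]/eqP aE; subst a b;
      by rewrite ?eqxx ?orbT // in nab *.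
  case/orP=> /andP[/eqP-> /eqP->]; first by rewrite axy eqxx.
  by rewrite adj_sym axy setUC eqxx.
rewrite big_setU1 ?inE ?xpair_eqE ?(negPf nxy) //= big_set1 /=.
by rewrite [(deg y + deg x)%N]addnC -mulr2n mulr_natl.
Qed.

(** * Deleting a vertex of minimum degree *)

Lemma deg_in_setD1 (G : sgraph) (S : {set G}) (v u : G) : v \in S ->
  deg_in S u = (adj u v + deg_in (S :\ v) u)%N.
Proof.
move=> vS; rewrite /deg_in (cardsD1 v) inE vS /=; congr (_ + _)%N.
by apply: eq_card => w; rewrite !inE andbA.
Qed.

Lemma sum_nbrs_setD1 (G : sgraph) (S : {set G}) (v u : G) (F : G -> rat) :
  v \in S -> \sum_(w in nbrs S u) F w
    = (adj u v)%:R * F v + \sum_(w in nbrs (S :\ v) u) F w.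
Proof.
move=> vS; have E : nbrs S u :\ v = nbrs (S :\ v) u.
  by apply/setP=> w; rewrite !inE andbA.
case auv: (adj u v); first by rewrite (big_setD1 v) ?inE ?vS // mul1r E.
rewrite mul0r add0r -E; apply: eq_bigl => w; rewrite !inE.
by have [->|] := eqVneq w v; rewrite ?auv ?andbF.
Qed.

Lemma sum_adj (G : sgraph) (S : {set G}) (v : G) (F : G -> rat) :
  \sum_(u in S :\ v) (adj u v)%:R * F u = \sum_(u in nbrs S v) F u.
Proof.
rewrite [RHS](eq_bigl (fun u => (u \in S :\ v) && adj u v)); last first.
  move=> u; rewrite !inE adj_sym.
  by have [->|] := eqVneq u v; rewrite ?adj_irr ?andbF.
rewrite big_mkcondr; apply: eq_bigr => u _.
by case: adj; rewrite ?mul1r ?mul0r.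
Qed.

(** Splits off the pairs containing v, keeping the degrees of S in the
    remaining sum; it thus separates the edges lost by deleting v from the
    change in the weights of the surviving ones. *)
Lemma harmonic_in_setD1 (G : sgraph) (S : {set G}) (v : G) : v \in S ->
  harmonic_in S =
    \sum_(u in nbrs S v) 2 / (deg_in S u + deg_in S v)%N%:R
    + \sum_(u in S :\ v) \sum_(w in nbrs (S :\ v) u)
        (deg_in S u + deg_in S w)%N%:R^-1.
Proof.
move=> vS; rewrite /harmonic_in (big_setD1 v) //=.
under [X in _ + X]eq_bigr => u _ do rewrite (sum_nbrs_setD1 _ _ vS).
rewrite big_split /= sum_adj addrA -big_split /=; congr (_ + _).
by apply: eq_bigr => u _; rewrite [(deg_in S v + _)%N]addnC -mulr2n mulr_natl.
Qed.

(** Controls the growth of an edge weight 1 / s when j of its ends lose a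
    neighbor.  The bound on the increment is linear in j, so it can be charged separately to each of
    the two ends. *)
Lemma inv_shift_le (s j c : rat) : 0 <= j -> j <= c -> c < s ->
  (s - j)^-1 <= s^-1 + j / (s * (s - c)).
Proof.
move=> j0 jc cs.
have s0 : 0 < s by lra.
have sj0 : 0 < s - j by lra.
have sc0 : 0 < s - c by lra.
have -> : (s - j)^-1 = s^-1 + j / (s * (s - j)).
  by field; rewrite !gt_eqF.
rewrite lerD2l ler_wpM2l // lef_pV2 ?posrE ?mulr_gt0 //.
by rewrite ler_pM2l //; lra.
Qed.

(** Let d be the degree of v.  Deleting v loses 2 / (d(u) + d) for each
    neighbor u, and every edge uw that stays gains at most e(u, w) for each
    of its ends adjacent to v.  With c = min(d, 2), which bounds the number
    of such ends, e(u, w) is at most 1 / ((d(u) + d) (d(u) + d - c)) because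
    d(w) >= d, and only d(u) - 1 edges at u remain; since c < d + 1, the
    total growth charged to u is less than its loss.  The positive balance
    at u is g u, and the factor 2 comes from counting ordered pairs. *)
Lemma harmonic_in_peel (G : sgraph) (S : {set G}) (v : G) : v \in S ->
    {in S, forall u, (deg_in S v <= deg_in S u)%N} ->
  exists2 g : G -> rat, {in nbrs S v, forall u, 0 < g u} &
    harmonic_in (S :\ v) + \sum_(u in nbrs S v) g u <= harmonic_in S.
Proof.
move=> vS vmin; set d := deg_in S v.
pose D (u : G) : rat := (deg_in S u)%:R.
pose c : rat := (minn d 2)%:R.
pose a (u : G) : rat := (adj u v)%:R.
pose e u w : rat := ((D u + D w) * (D u + D w - c))^-1.
have Dbig u w : u \in S -> w \in nbrs S u -> c < D u + D w.
  move=> uS wu; have /andP[wS] : (w \in S) && (u \in nbrs S w).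
    by rewrite -in_nbrs_sym uS.
  move=> /nbr_deg_gt0; move: (nbr_deg_gt0 wu).
  move: (vmin u uS) (vmin w wS); rewrite -/d /c /D -natrD ltr_nat.
  by lia.
exists (fun u => 2 / (D u + d%:R)
          - 2 * \sum_(w in nbrs (S :\ v) u) e u w).
  move=> u; rewrite inE => /andP[uS avu].
  have cs : c < D u + d%:R.
    have := Dbig v u vS; rewrite inE uS avu addrC; exact.
  have c0 : 0 <= c by rewrite ler0n.
  have Du : (deg_in (S :\ v) u)%:R = D u - 1.
    by rewrite /D (deg_in_setD1 _ vS) adj_sym avu natrD addrAC subrr add0r.
  have Hsum : \sum_(w in nbrs (S :\ v) u) e u w
      <= (D u - 1) / ((D u + d%:R) * (D u + d%:R - c)).
    rewrite -Du -sum_nbrs_const.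
    apply: ler_sum => w; rewrite !inE => /andP[/andP[wv wS] auw].
    have dw : d%:R <= D w by rewrite ler_nat vmin.
    rewrite lef_pV2 ?posrE ?mulr_gt0; try lra.
    by apply: ler_pM; lra.
  rewrite -mulrBr mulr_gt0 // subr_gt0; apply: le_lt_trans Hsum _.
  rewrite ltr_pdivrMr ?mulr_gt0; try lra.
  rewrite mulrA mulVf ?mul1r; last by rewrite gt_eqF //; lra.
  suff : c < d%:R + 1 by lra.
  by rewrite /c natr1 ltr_nat; lia.
rewrite (harmonic_in_setD1 vS).
have Hterm u w : u \in S :\ v -> w \in nbrs (S :\ v) u ->
    (deg_in (S :\ v) u + deg_in (S :\ v) w)%N%:R^-1
      <= (D u + D w)^-1 + (a u * e u w + a w * e w u).
  rewrite !inE => /andP[uv uS] /andP[/andP[wv wS] auw].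
  have wu : w \in nbrs S u by rewrite inE wS.
  have -> : (deg_in (S :\ v) u + deg_in (S :\ v) w)%N%:R
      = D u + D w - (a u + a w).
    rewrite /D !(deg_in_setD1 _ vS) /a !natrD; ring.
  have -> : e w u = e u w by rewrite /e [D w + _]addrC.
  rewrite -mulrDl; apply: inv_shift_le; last exact: Dbig.
    by rewrite addr_ge0 ?ler0n.
  (* the ends of uw adjacent to v are distinct neighbors of v, hence also
     at most d in number *)
  rewrite /a /c -natrD ler_nat leq_min; apply/andP; split;
    last by do 2!case: adj.
  have nuw : u != w by apply: contraTneq auw => ->; rewrite adj_irr.
  rewrite /d /deg_in (cardsD1 u) (cardsD1 w) !inE uS wS adj_sym.
  by rewrite [adj v w]adj_sym eq_sym nuw /= addnA leq_addr.
have {Hterm} Hle : harmonic_in (S :\ v) <=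
    \sum_(u in S :\ v) \sum_(w in nbrs (S :\ v) u)
      ((D u + D w)^-1 + (a u * e u w + a w * e w u)).
  by apply: ler_sum => u uS; apply: ler_sum => w wu; apply: Hterm.
(* exchanging u and w in the pairs turns the charge of w into that of u *)
have E1 : \sum_(u in S :\ v) \sum_(w in nbrs (S :\ v) u)
      ((D u + D w)^-1 + (a u * e u w + a w * e w u))
  = \sum_(u in S :\ v) \sum_(w in nbrs (S :\ v) u) (D u + D w)^-1
    + 2 * \sum_(u in nbrs S v) \sum_(w in nbrs (S :\ v) u) e u w.
  under eq_bigr => u _ do rewrite big_split big_split /=.
  rewrite !big_split /=; congr (_ + _).
  rewrite [X in _ + X]sum_nbrs_swap -mulr2n mulr_natl; congr (_ *+ 2).
  by under eq_bigr => u _ do rewrite -mulr_sumr; rewrite sum_adj.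
rewrite {}E1 in Hle.
rewrite sumrB -!mulr_sumr.
have E2 : \sum_(u in nbrs S v) (deg_in S u + deg_in S v)%N%:R^-1
   = \sum_(u in nbrs S v) (D u + d%:R)^-1 :> rat.
  by apply: eq_bigr => u _; rewrite natrD.
have E3 : \sum_(u in S :\ v) \sum_(w in nbrs (S :\ v) u)
        (deg_in S u + deg_in S w)%N%:R^-1
    = \sum_(u in S :\ v) \sum_(w in nbrs (S :\ v) u) (D u + D w)^-1 :> rat.
  by apply: eq_bigr => u _; apply: eq_bigr => w _; rewrite natrD.
rewrite E2 E3; lra.
Qed.

Lemma harmonic_in_peel_le (G : sgraph) (S : {set G}) (v : G) : v \in S ->
    {in S, forall u, (deg_in S v <= deg_in S u)%N} ->
  harmonic_in (S :\ v) <= harmonic_in S.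
Proof.
move=> vS vmin; have [g g0] := harmonic_in_peel vS vmin.
apply: le_trans; rewrite lerDl; apply: sumr_ge0 => u /g0; exact: ltW.
Qed.

Lemma harmonic_in_peel_lt (G : sgraph) (S : {set G}) (v : G) : v \in S ->
    {in S, forall u, (deg_in S v <= deg_in S u)%N} ->
    (0 < deg_in S v)%N ->
  harmonic_in (S :\ v) < harmonic_in S.
Proof.
move=> vS vmin /card_gt0P[u uv].
have [g g0] := harmonic_in_peel vS vmin.
apply: lt_le_trans; rewrite ltrDl (big_setD1 u) //=.
rewrite ltr_pwDl ?g0 //; apply: sumr_ge0 => w; rewrite inE => /andP[_ /g0].
exact: ltW.
Qed.

(** * Subgraphs of large minimum degree *)

Lemma deg_in_lt_card (G : sgraph) (S : {set G}) (u : G) :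
  u \in S -> (deg_in S u < #|S|)%N.
Proof.
move=> uS; rewrite (cardsD1 u S) uS add1n ltnS; apply: subset_leq_card.
apply/subsetP => w; rewrite !inE => /andP[-> auw]; rewrite andbT.
by apply: contraTneq auw => ->; rewrite adj_irr.
Qed.

Lemma clique_of_min_deg (G : sgraph) (S : {set G}) (d : nat) :
    {in S, forall u, (d <= deg_in S u)%N} -> (#|S| <= d.+1)%N ->
  is_clique S.
Proof.
move=> dS cS u w uS wS uw.
have : nbrs S u == S :\ u.
  rewrite eqEcard; apply/andP; split.
    apply/subsetP => x; rewrite !inE => /andP[-> aux]; rewrite andbT.
    by apply: contraTneq aux => ->; rewrite adj_irr.
  move: cS; rewrite (cardsD1 u S) uS add1n ltnS => /leq_trans; apply.
  exact: dS.
by move/eqP/setP/(_ w); rewrite !inE wS eq_sym uw.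
Qed.

(** The function x / (x + M) is increasing, so every vertex contributes at
    least d / (d + M) to H, where M is the maximum degree; the vertex w of
    degree M is counted apart because it contributes 1 / 2 at least.  If S has
    m vertices and is not a clique, then d < m - 1, so d + M < 2 (m - 1) and the resulting bound
    exceeds d + 1. *)
Lemma harmonic_in_min_deg (G : sgraph) (S : {set G}) (d : nat) :
    (0 < d)%N -> S != set0 -> {in S, forall u, (d <= deg_in S u)%N} ->
  d.+1%:R <= 2 * harmonic_in S /\
  (d.+1%:R = 2 * harmonic_in S -> is_clique S).
Proof.
move=> d0 /set0Pn[x xS] dS.
have [w wS wmax] := arg_maxnP (deg_in S) xS.
have {}wS : w \in S := wS.
set M := deg_in S w in wmax.
have dM : (d <= M)%N by apply: dS.
have Mm : (M < #|S|)%N by apply: deg_in_lt_card.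
pose m1 := #|S|.-1.
have Dpos : 0 < d%:R :> rat by rewrite ltr0n.
have dMr : d%:R <= M%:R :> rat by rewrite ler_nat.
have term u : u \in S ->
    (deg_in S u)%:R / (deg_in S u + M)%N%:R
      <= \sum_(z in nbrs S u) (deg_in S u + deg_in S z)%N%:R^-1 :> rat.
  move=> uS; rewrite -sum_nbrs_const.
  apply: ler_sum => z; rewrite inE => /andP[zS auz].
  have := dS u uS; have := dS z zS => dz du.
  rewrite lef_pV2 ?posrE ?ltr0n ?ler_nat; try lia.
  by rewrite leq_add2l; apply: wmax.
have term2 u : u \in S ->
    d%:R / (d%:R + M%:R) <= (deg_in S u)%:R / (deg_in S u + M)%N%:R :> rat.
  move=> uS; have : d%:R <= (deg_in S u)%:R :> rat by rewrite ler_nat dS.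
  rewrite natrD; move: (deg_in S u)%:R => y dy.
  rewrite ler_pdivrMr; last by lra.
  rewrite mulrAC ler_pdivlMr; last by lra.
  have := ler_wpM2r (ltW (lt_le_trans Dpos dMr)) dy; lra.
have key : 1 + 2 * (m1%:R * (d%:R / (d%:R + M%:R))) <= 2 * harmonic_in S.
  rewrite /harmonic_in (big_setD1 w) //= mulrDr; apply: lerD.
    have := term w wS; rewrite natrD -/M.
    have -> : M%:R / (M%:R + M%:R) = 1 / 2 :> rat.
      by field; rewrite gt_eqF //; lra.
    lra.
  rewrite ler_pM2l //.
  have -> : m1 = #|S :\ w| by rewrite /m1 (cardsD1 w S) wS.
  rewrite -sum1_card natr_sum mulr_suml; apply: ler_sum => u.
  rewrite inE mul1r => /andP[_ uS].
  exact: le_trans (term2 u uS) (term u uS).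
have fr : 2 * (m1%:R * (d%:R / (d%:R + M%:R)))
    = d%:R * ((2 * m1%:R) / (d%:R + M%:R)) :> rat.
  by field; rewrite gt_eqF //; lra.
have Mm1 : M%:R <= m1%:R :> rat by rewrite ler_nat /m1; lia.
have dMpos : 0 < d%:R + M%:R :> rat by lra.
split.
  apply: le_trans key; rewrite -add1n natrD lerD2l fr ler_peMr //.
  by rewrite ler_pdivlMr // mul1r; lra.
move=> eqH; apply: (clique_of_min_deg dS); rewrite leqNgt; apply/negP => lt.
have dm1 : d%:R < m1%:R :> rat by rewrite ltr_nat /m1; lia.
move: key; rewrite -eqH -[d.+1]add1n natrD lerD2l fr leNgt => /negP; apply.
by rewrite ltr_pMr // ltr_pdivlMr // mul1r; lra.
Qed.

Lemma deg_in_subset (G : sgraph) (S T : {set G}) (u : G) :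
  T \subset S -> (deg_in T u <= deg_in S u)%N.
Proof.
move=> TS; apply: subset_leq_card; apply/subsetP => w.
by rewrite !inE => /andP[/(subsetP TS)-> ->].
Qed.

(** Induction on S, deleting a vertex of minimum degree as long as that degree
    is below d.  Such a vertex is outside T, so T survives.  Only the first
    deletion has to be strict for the equality case: the induction hypothesis
    is used there as a mere inequality, since later subgraphs may well have
    isolated vertices. *)
Lemma harmonic_in_core (G : sgraph) (d : nat) (T S : {set G}) :
    (0 < d)%N -> T != set0 -> {in T, forall u, (d <= deg_in T u)%N} ->
    T \subset S ->
  d.+1%:R <= 2 * harmonic_in S /\
  ({in S, forall u, (0 < deg_in S u)%N} ->
     d.+1%:R = 2 * harmonic_in S -> is_clique S).
Proof.
move=> d0 T0 dT; have [n] := ubnP #|S|; elim: n S => // n IHn S Sn TS.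
have [x xT] := set0Pn _ T0; have xS := subsetP TS x xT.
have [v vS vmin] := arg_minnP (deg_in S) xS.
have {}vS : v \in S := vS.
have [dv|vd] := leqP d (deg_in S v).
  have dS : {in S, forall u, (d <= deg_in S u)%N}.
    by move=> u uS; apply: leq_trans dv (vmin u uS).
  have S0 : S != set0 by apply/set0Pn; exists x.
  by have [? ?] := harmonic_in_min_deg d0 S0 dS.
have vT : v \notin T.
  apply: contraL vd => /dT dv.
  by rewrite -leqNgt (leq_trans dv) ?deg_in_subset.
have [||le _] := IHn (S :\ v).
- by move: Sn; rewrite (cardsD1 v S) vS.
- by rewrite subsetD1 TS.
split; first by have := harmonic_in_peel_le vS vmin; lra.
move=> pos eqH; have := harmonic_in_peel_lt vS vmin (pos v vS); lra.
Qed.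

(** * Orderings and the coloring number *)

(** The ordering is built from its end: a vertex of degree below k in S comes
    last, so its earlier neighbors are at most its neighbors in S, and the
    rest of S is ordered by induction. *)
Lemma greedy_order (G : sgraph) (k : nat) (S : {set G}) :
    (forall T : {set G}, T != set0 ->
       exists2 v, v \in T & (deg_in T v < k)%N) ->
  exists p : G -> nat, [/\ {in S &, injective p},
    {in S, forall u, (p u < #|S|)%N} &
    {in S, forall v, (#|[set u in S | adj v u & (p u < p v)%N]| < k)%N}].
Proof.
move=> degen; have [n] := ubnP #|S|; elim: n S => // n IHn S Sn.
have [->|S0] := eqVneq S set0.
  by exists (fun=> 0%N); split=> [u v|u|u]; rewrite inE.
have [v vS vk] := degen S S0.
have cS : #|S| = #|S :\ v|.+1 by rewrite (cardsD1 v S) vS.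
have [|p [pinj plt pk]] := IHn (S :\ v); first by rewrite -ltnS -cS.
have inD u : u \in S -> u != v -> u \in S :\ v by rewrite !inE => -> ->.
exists (fun u => if u == v then #|S :\ v| else p u); split.
- move=> u w uS wS; case: eqVneq => [->|uv]; case: eqVneq => [->|wv] //.
  + by move=> E; have := plt w (inD w wS wv); rewrite -E ltnn.
  + by move=> E; have := plt u (inD u uS uv); rewrite -E ltnn.
  + by apply: pinj; apply: inD.
- move=> u uS; rewrite cS ltnS; case: eqVneq => // uv.
  by apply: ltnW; apply/plt/inD.
move=> u uS; case: eqVneq => [->|uv].
  apply: leq_ltn_trans vk; apply: subset_leq_card; apply/subsetP => w.
  by rewrite !inE => /and3P[-> ->].
apply: leq_ltn_trans (pk u (inD u uS uv)); apply: subset_leq_card.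
apply/subsetP => w; rewrite !inE => /and3P[wS auw].
case: eqVneq => [_|wv]; last by rewrite wS auw.
by rewrite ltnNge ltnW // plt ?inD.
Qed.

Lemma dense_core (G : sgraph) (k : nat) : ~~ has_col_order G k ->
  exists2 T : {set G}, T != set0 & {in T, forall u, (k <= deg_in T u)%N}.
Proof.
move=> nk.
case: (boolP [exists T : {set G}, (T != set0) &&
               [forall u in T, (k <= deg_in T u)%N]]) => [/existsP|none].
  by case=> T /andP[T0 /forall_inP kT]; exists T.
case/negP: nk.
have [|p [pinj plt pk]] := @greedy_order G k setT.
  move=> T T0; move/existsPn/(_ T): none; rewrite T0 /= => /forall_inPn[v vT].
  by rewrite -ltnNge; exists v.
have {}plt u : (p u < gorder G)%N by rewrite /gorder -cardsT plt.
apply/existsP; exists [ffun u => Ordinal (plt u)]; apply/andP; split.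
  by apply/injectiveP => u v; rewrite !ffunE => -[]; apply: pinj.
apply/forallP => v; apply: leq_ltn_trans (pk v _) => //.
by apply: subset_leq_card; apply/subsetP => u; rewrite !inE !ffunE.
Qed.

(** Ensures that d = k - 1 is positive when k is the coloring number, as the
    lower bound on H requires. *)
Lemma col_order_gt1 (G : sgraph) (k : nat) (x y : G) :
  adj x y -> has_col_order G k -> (1 < k)%N.
Proof.
move=> axy /existsP[p /andP[/injectiveP pinj /forallP pk]].
suff [u [v [avu lt]]] : exists u v : G, adj v u /\ (p u < p v)%N.
  by apply: leq_ltn_trans (pk v); apply/card_gt0P; exists u; rewrite inE avu.
have : p x != p y by apply: contraTneq axy => /pinj->; rewrite adj_irr.
rewrite -(inj_eq val_inj) neq_ltn => /orP[] lt; last by exists y, x.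
by exists x, y; rewrite adj_sym.
Qed.

(** The last vertex of the ordering is preceded by all the others, which are
    its neighbors. *)
Lemma clique_col_order (G : sgraph) (k : nat) :
  (0 < gorder G)%N -> is_clique [set: G] -> has_col_order G k ->
  (gorder G <= k)%N.
Proof.
move=> /card_gt0P[x _] clq /existsP[p /andP[/injectiveP pinj /forallP pk]].
have [v _ vmax] := arg_maxnP (fun u => p u : nat) (isT : xpredT x).
have -> : gorder G = #|[set: G] :\ v|.+1.
  by rewrite /gorder -cardsT (cardsD1 v) inE.
apply: leq_trans (pk v); rewrite ltnS.
apply: subset_leq_card; apply/subsetP => u; rewrite !inE andbT => uv.
rewrite clq ?inE 1?eq_sym //= ltn_neqAle.
by rewrite (inj_eq val_inj) (inj_eq pinj) uv; apply: vmax.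
Qed.

Lemma harmonic_in_clique (G : sgraph) (S : {set G}) :
  (1 < #|S|)%N -> is_clique S -> 2 * harmonic_in S = #|S|%:R.
Proof.
move=> S1 clq.
have degE u : u \in S -> deg_in S u = #|S|.-1.
  move=> uS; rewrite (cardsD1 u S) uS /=; apply: eq_card => w; rewrite !inE.
  have [->|wu] := eqVneq w u; first by rewrite adj_irr andbF.
  by case wS: (w \in S) => //=; rewrite clq // eq_sym.
have -> : harmonic_in S = \sum_(u in S) (1 / 2).
  apply: eq_bigr => u uS.
  transitivity (\sum_(w in nbrs S u) (#|S|.-1 + #|S|.-1)%N%:R^-1 : rat).
    by apply: eq_bigr => w; rewrite inE => /andP[wS _]; rewrite !degE.
  rewrite sum_nbrs_const degE // natrD.
  have m0 : 0 < #|S|.-1%:R :> rat by rewrite ltr0n; lia.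
  by field; rewrite gt_eqF //; lra.
by rewrite sumr_const -mulr_natl; field.
Qed.

Lemma isomorphic_completeP (G : sgraph) :
  isomorphic G (complete (gorder G)) <-> is_clique [set: G].
Proof.
split=> [[f fbij fadj] u v _ _ uv|clq].
  by rewrite -fadj /= /complete_rel (inj_eq (bij_inj fbij)).
exists (enum_rank : G -> complete (gorder G)).
  exact: enum_rank_bij.
move=> u v; rewrite /= /complete_rel (inj_eq enum_rank_inj).
by have [->|uv] := eqVneq u v; [rewrite adj_irr|rewrite clq ?inE].
Qed.

Theorem corollary1p7 (G : sgraph) (n : nat) (hn : gorder G = n)
    (hn0 : (0 < n)%N) (hni : no_isolated G) :
  (coloring_number G)%:R <= 2 * harmonic G /\
  ((coloring_number G)%:R = 2 * harmonic G <-> isomorphic G (complete n)).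
Proof.
subst n; rewrite harmonic_setT isomorphic_completeP.
have [x _] := card_gt0P hn0; have [y xy] := card_gt0P (hni x).
rewrite inE in xy.
rewrite /coloring_number; case: ex_minnP => k kcol kmin.
have k1 : (1 < k)%N := col_order_gt1 xy kcol.
have [|T T0 kT] := @dense_core G k.-1; first by apply/negP => /kmin; lia.
have d0 : (0 < k.-1)%N by lia.
have [] := harmonic_in_core d0 T0 kT (subsetT T).
rewrite prednK; last by lia.
move=> le eqclq; split=> //; split=> [|clq].
  by apply: eqclq => u _; rewrite deg_in_setT.
apply/eqP; rewrite eq_le le /=.
have kn := clique_col_order hn0 clq kcol.
rewrite harmonic_in_clique // ?cardsT ?ler_nat //.
apply/card_gt1P; exists x, y; split=> //.
by apply: contraTneq xy => ->; rewrite adj_irr.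
Qed.
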